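(* Let $X=K_{n_1,\ldots,n_k}$ be a complete multipartite graph and $n=\sum_{j=1}^kn_j$. Let $\ell\in\{1,\ldots,k\}$ and let $u$ be a vertex of $X$ in the partite set of size $n_\ell$. With respect to the Laplacian $L=L(X)$: (1) If $n_\ell=1$, then $u$ is tightly $(1-\frac2n)$-sedentary at time $t=\frac{j\pi}{n}$ for any odd $j$. (2) If $n_\ell=2$ and $n\equiv0\pmod 4$, then the two vertices in the partite set of size $n_\ell$ admit perfect state transfer with minimum PST time $\frac{\pi}{2}$. (3) If $n_\ell=2$ and $n\equiv2\pmod4$, then $u$ is tightly $(\frac2n)$-sedentary at time $t=\frac{j\pi}{2}$ for any odd $j$. (4) Let $n_\ell=2$ and $n$ odd. If $n=3$, then $u$ is tightly $(\frac13)$-sedentary at time $t=j\pi$ for any odd $j$. If $n\ge5$, then $u$ is tightly $(\frac{\sqrt2}{n})$-sedentary at time $t=\frac{j\pi}{2}$ for any odd $j$. (5) If $n_\ell\ge3$, then $u$ is tightly $C$-sedentary, where $C=1-\frac{2}{n_\ell}$ (attained at time $t=\frac{j\pi}{g}$, $g=\gcd(n,n_\ell)$, $j$ any odd integer) whenever $\nu_2(n)>\nu_2(n_\ell)$, and $C>1-\frac{2}{n_\ell}$ otherwise.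
   Context: $K_{n_1,\ldots,n_k}$ is the simple unweighted graph whose vertex set is partitioned into independent sets of sizes $n_1,\ldots,n_k$ with every pair of vertices in different parts adjacent. $L(X)=D(X)-A(X)$ is the Laplacian; $U_L(t)=e^{itL}$ (equivalently $e^{-itL}$ gives the same moduli). Perfect state transfer (PST) between $u,v$ at time $\tau$: $|U(\tau)_{u,v}|=1$; the minimum such $\tau>0$ is the minimum PST time. A vertex $u$ is tightly $C$-sedentary at time $t_0$ if $\inf_{t>0}|U(t)_{u,u}|=C>0$ and this infimum is attained at $t_0$. $\nu_2(a)$ is the exponent of the largest power of $2$ dividing $a$.
   Formalization: Part (1) is claimed for n ≥ 3; for n = 2 (K_2) the infimum is 1−2/n = 0, so only its value and attainment are stated, since sedentariness needs C > 0; n = 1 (K_1) is excluded because |U(t)_{u,u}| = 1 while 1−2/n = −1. *)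

(* Defs.v *)
From HB Require Import structures.
From mathcomp Require Import all_boot all_order all_algebra.
From mathcomp Require Import all_classical all_reals all_analysis.
From mathcomp Require Import complex.

Set Implicit Arguments.
Unset Strict Implicit.
Unset Printing Implicit Defensive.

Import Order.TTheory GRing.Theory Num.Theory.
Import numFieldNormedType.Exports.
Local Open Scope classical_set_scope.
Local Open Scope ring_scope.
Local Open Scope complex_scope.

Definition multipartite_vertex (k : nat) (m : 'I_k -> nat) : finType :=
  {j : 'I_k & 'I_(m j)}.

Definition multipartite_adj (k : nat) (m : 'I_k -> nat) :
    rel (multipartite_vertex m) :=
  fun u v => tag u != tag v.

Section Laplacian.
Variables (R : realType) (V : finType) (e : rel V).

(* Matrices are indexed by 'I_#|V|, the vertex of index i being enum_val i. *)
Definition adjacency_mx : 'M[R[i]]_#|V| :=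
  \matrix_(a, b) (e (enum_val a) (enum_val b))%:R.

Definition degree_mx : 'M[R[i]]_#|V| :=
  diag_mx (\row_a (#|[set v | e (enum_val a) v]%SET|)%:R).

Definition laplacian_mx : 'M[R[i]]_#|V| := degree_mx - adjacency_mx.

End Laplacian.

Definition expmx (K : numFieldType) (n : nat) (A : 'M[K]_n) : 'M[K]_n :=
  limn (series (fun p : nat => (p`!%:R)^-1 *: A ^+ p)).

Section QuantumWalk.
Variables (R : realType) (V : finType) (e : rel V).

Definition transition_mx (t : R) : 'M[R[i]]_#|V| :=
  expmx ((0 +i* t) *: laplacian_mx R e).

(* The modulus is taken with Normc.normc, which is valued in R, because the
   norm of R[i] as a numDomainType is valued in R[i]. *)
Definition transition_modulus (t : R) (u v : V) : R :=
  Normc.normc (transition_mx t (enum_rank u) (enum_rank v)).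

Definition perfect_state_transfer_at (u v : V) (tau : R) : Prop :=
  transition_modulus tau u v = 1.

Definition minimum_PST_time (u v : V) (tau : R) : Prop :=
  [/\ 0 < tau, perfect_state_transfer_at u v tau &
      forall s : R, 0 < s -> perfect_state_transfer_at u v s -> tau <= s].

Definition return_inf_attained_at (u : V) (C t0 : R) : Prop :=
  inf [set transition_modulus t u u | t in [set t : R | 0 < t]] = C /\
  transition_modulus t0 u u = C.

Definition tightly_sedentary_at (u : V) (C t0 : R) : Prop :=
  0 < C /\ return_inf_attained_at u C t0.

End QuantumWalk.

Arguments transition_modulus {R V} e t u v.
Arguments minimum_PST_time {R V} e u v tau.
Arguments return_inf_attained_at {R V} e u C t0.
Arguments tightly_sedentary_at {R V} e u C t0.

(* Main.v *)
(** Write [a] for the size of the part of [u].  The Laplacian has eigenvalues [0],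
    [n] and [n - a_j], so the return amplitude at [u] is
      [1/n + (1 - 1/a) e^(it(n-a)) + (1/a - 1/n) e^(itn)].
    For [a = 1] the claim is immediate, and for [a >= 3] the triangle inequality
    gives the bound [1 - 2/a], attained iff [cos (t a) = -1] and [cos (t n) = 1];
    as [n' a = a' n] for suitable cofactors, these two phases are compatible exactly
    when [v_2(n) > v_2(a)].
    For [a = 2] the squared modulus has, up to a constant, derivative
    [sin ((n-2)t) + sin (2t) + sin (nt) = 4 sin (nt/2) cos ((n-2)t/2) cos t], so a global
    minimiser is a zero of one of the three factors.  Zeros of the first two give
    modulus [q |sin y|] with [y = pi/2 - t] and [cos (q' y) = 0] for an integer [q'],
    which is bounded below through [|sin (q' y)| <= q' |sin y|]. *)

Require Import Defs.
From HB Require Import structures.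
From mathcomp Require Import all_boot all_order all_algebra.
From mathcomp Require Import all_classical all_reals all_analysis.
From mathcomp Require Import complex.
From mathcomp Require Import zify ring lra.

Set Implicit Arguments.
Unset Strict Implicit.
Unset Printing Implicit Defensive.

Import Order.TTheory GRing.Theory Num.Theory.
Import numFieldNormedType.Exports.
Local Open Scope ring_scope.

(** * The exponential of a diagonalised matrix *)

Lemma cvg_mx_entry (T : topologicalType) (p q : nat) (F : nat -> 'M[T]_(p, q))
    (M : 'M[T]_(p, q)) :
  (forall i j, (fun N => F N i j) @ \oo --> M i j)%classic ->
  (F @ \oo --> M)%classic.
Proof.
move=> FM A [P nP PA]; rewrite nbhs_simpl /=.
have : (\forall N \near \oo, forall i, forall j, P i j (F N i j))%classic.
  by apply: filter_forall => i; apply: filter_forall => j; exact: FM (nP i j).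
by apply: filterS => N PN; apply: PA.
Qed.

(** Uniqueness of limits is applied to entries, the only place where [T] must be Hausdorff: those of
    [F] converge both to those of [limn F] and to those of [M]. *)
Lemma lim_mx_entry (T : ptopologicalType) (p q : nat) (F : nat -> 'M[T]_(p, q))
    (M : 'M[T]_(p, q)) : hausdorff_space T ->
  (forall i j, (fun N => F N i j) @ \oo --> M i j)%classic -> limn F = M.
Proof.
move=> hT FM; have FcM := cvg_mx_entry FM.
have FcL : (F @ \oo --> limn F)%classic by exact: (cvgP _ FcM).
apply/matrixP => i j.
have FLij : ((fun N => F N i j) @ \oo --> limn F i j)%classic.
  move=> A nA; apply: (FcL (fun N => A (N i j))).
  (* These neighbourhoods constrain the entry at [(i, j)] alone. *)
  pose P i' j' : set T := fun z => i' = i -> j' = j -> A z.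
  exists P => [i' j'|N NP]; last exact: (NP i j).
  have [->|/eqP ni] := eqVneq i' i; last first.
    by apply: filterS filterT => z _ /ni.
  have [->|/eqP nj] := eqVneq j' j; last first.
    by apply: filterS filterT => z _ _ /nj.
  by apply: filterS nA => z Az _ _.
by apply: (cvg_unique hT FLij); exact: FM.
Qed.

Definition expi (R : realType) (x : R) : (R[i] : numFieldType) := Complex (cos x) (sin x).

Lemma cvg_complex (R : realType) (a b : nat -> R) (x y : R) :
  (a @ \oo --> x)%classic -> (b @ \oo --> y)%classic ->
  ((fun N => Complex (a N) (b N) : (R[i] : numFieldType)) @ \oo -->
    (Complex x y : (R[i] : numFieldType)))%classic.
Proof.
move=> /cvgrPdist_lt ax /cvgrPdist_lt bY; apply/cvgrPdist_lt => -[e e'].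
(* In the order of [R[i]] a positive radius has zero imaginary part. *)
rewrite ltcE /= => /andP[/eqP -> e0].
have e20 : 0 < e / 2 by rewrite divr_gt0.
near=> N.
have h1 : `|x - a N| < e / 2 by near: N; exact: ax.
have h2 : `|y - b N| < e / 2 by near: N; exact: bY.
rewrite ltcE /= eqxx /= -(ger0_norm (ltW e0)) -sqrtr_sqr ltr_sqrt ?exprn_gt0//.
have -> : (x - a N) ^+ 2 + (y - b N) ^+ 2 = `|x - a N| ^+ 2 + `|y - b N| ^+ 2.
  by rewrite -!normrX !ger0_norm ?sqr_ge0.
have := normr_ge0 (x - a N); have := normr_ge0 (y - b N).
move: h1 h2; set u := `|_|; set v := `|_| => h1 h2 h3 h4.
have : u * u <= e / 2 * (e / 2) by apply: ler_pM => //; exact: ltW.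
have : v * v <= e / 2 * (e / 2) by apply: ler_pM => //; exact: ltW.
have : 0 < e * e by exact: mulr_gt0.
by rewrite !expr2; lra.
Unshelve. all: by end_near. Qed.

(** The power [i^p] is real for even [p] and imaginary for odd [p], with alternating signs, so the
    exponential series splits termwise into the cosine and sine series. *)
Lemma exprI_cos_sin_coeff (R : realType) (x : R) (p : nat) :
  (p`!%:R)^-1 * (Complex 0 x) ^+ p = Complex (cos_coeff x p) (sin_coeff x p) :> R[i].
Proof.
have -> : (Complex 0 x) ^+ p = Complex ((~~ odd p)%:R * (-1) ^+ p./2 * x ^+ p)
     ((odd p)%:R * (-1) ^+ p.-1./2 * x ^+ p) :> R[i].
  elim: p => [|p IH]; first by rewrite /= !expr0 !mulr1.
  rewrite exprS IH.
  rewrite -[Complex 0 x * _]/(Complex _ _) /= uphalf_half.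
  case: p {IH} => [|p].
    by rewrite /= !expr0 expr1; congr Complex; ring.
  rewrite /= uphalf_half !negbK.
  case: (boolP (odd p)) => /= _; rewrite ?addn0 ?add0n ?add1n ?exprS; congr Complex; ring.
have -> : ((p`!%:R)^-1 : R[i]) = Complex ((p`!%:R)^-1 : R) 0.
  rewrite -[Complex _ _]/((p`!%:R : R)^-1%:C)%C.
  by rewrite fmorphV rmorph_nat.
rewrite -[_ * _]/(Complex _ _) /cos_coeff /sin_coeff /=.
by congr Complex; rewrite ?exprnP; ring.
Qed.

Lemma cvg_expi (R : realType) (x : R) :
  (series (fun p => (p`!%:R)^-1 * (Complex 0 x) ^+ p : (R[i] : numFieldType))
     @ \oo --> expi x)%classic.
Proof.
have -> : series (fun p => (p`!%:R)^-1 * (Complex 0 x) ^+ p : (R[i] : numFieldType)) =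
  (fun N => Complex (series (cos_coeff x) N) (series (sin_coeff x) N)).
  apply/funext => N; rewrite /series /=.
  elim: N => [|N IH]; first by rewrite !big_geq.
  by rewrite !big_nat_recr //= IH exprI_cos_sin_coeff.
apply: cvg_complex.
  by rewrite unlock; apply: is_cvg_series_cos_coeff.
by rewrite unlock; apply: is_cvg_series_sin_coeff.
Qed.

Lemma expr_scalemx (K : comPzRingType) (p : nat) (c : K) (A : 'M[K]_p) (q : nat) :
  (c *: A) ^+ q = c ^+ q *: A ^+ q.
Proof.
elim: q => [|q IH]; first by rewrite !expr0 scale1r.
rewrite !exprS IH -[LHS]/(_ *m _) -[X in _ = _ *: X]/(_ *m _).
by rewrite -scalemxAl -scalemxAr scalerA.
Qed.

(** Induction gives [A^q = \sum_s lam_s^q E_s], so each entry of the matrix series is a finite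
    combination of scalar exponential series. *)
Lemma expmx_spectral (R : realType) (p : nat) (A : 'M[R[i]]_p) (I : finType)
    (lam : I -> R) (E : I -> 'M[R[i]]_p) (t : R) :
  \sum_s E s = 1%:M ->
  (forall s, A *m E s = real_complex R (lam s) *: E s) ->
  expmx (Complex 0 t *: A) = \sum_s expi (t * lam s) *: E s.
Proof.
move=> E1 AE.
have Aq q : A ^+ q = \sum_s (real_complex R (lam s)) ^+ q *: E s.
  elim: q => [|q IH]; first by under [RHS]eq_bigr do rewrite expr0 scale1r; rewrite E1.
  rewrite exprS IH mulr_sumr; apply: eq_bigr => s _.
  by rewrite -[LHS]/(_ *m _) -scalemxAr AE scalerA -exprSr.
apply: lim_mx_entry; first exact: norm_hausdorff.
move=> i j.
have -> : (fun N => series (fun q => (q`!%:R)^-1 *: (Complex 0 t *: A) ^+ q) N i j) =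
  (fun N => \sum_s series (fun q =>
     (q`!%:R)^-1 * (Complex 0 (t * lam s)) ^+ q : (R[i] : numFieldType)) N * E s i j).
  apply/funext => N; rewrite /series /= summxE.
  under [RHS]eq_bigr do rewrite mulr_suml.
  rewrite exchange_big /=; apply: eq_bigr => q _.
  rewrite mxE expr_scalemx Aq mxE summxE mulrA mulr_sumr; apply: eq_bigr => s _.
  have itl : Complex 0 t * real_complex R (lam s) = Complex 0 (t * lam s).
    by rewrite -[LHS]/(Complex _ _) /=; congr Complex; ring.
  by rewrite mxE mulrA -itl exprMn mulrA.
rewrite summxE.
under eq_bigr do rewrite mxE.
apply: cvg_big => [|s _]; first exact: add_continuous.
by apply: cvgMl; exact: cvg_expi.
Qed.

(** * The Laplacian spectrum of a complete multipartite graph *)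

(* Squared modulus of [a + b e^(ix) + c e^(iy)]. *)
Definition sqnorm3 (R : realType) (a b c x y : R) : R :=
  (a + b * cos x + c * cos y) ^+ 2 + (b * sin x + c * sin y) ^+ 2.

Lemma big_option (K : nmodType) (T : finType) (F : option T -> K) :
  \sum_s F s = F None + \sum_x F (Some x).
Proof.
rewrite (bigD1 None) //=; congr (_ + _).
rewrite (reindex_omap Some id) => [|[x|] //]; apply: eq_bigl => x.
by rewrite eqxx.
Qed.

Section MultipartiteSpectrum.
Variables (R : realType) (k : nat) (m : 'I_k -> nat).
Hypothesis m_gt0 : forall j, (0 < m j)%N.
Let V := multipartite_vertex m.
Let n := (\sum_(j < k) m j)%N.

Lemma sum_part_cst (K : pzSemiRingType) (j : 'I_k) (c : K) :
  \sum_(v : V | tag v == j) c = (m j)%:R * c.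
Proof.
rewrite sumr_const mulr_natl; congr (_ *+ _).
have inj_j : injective (fun x : 'I_(m j) => Tagged (fun j => 'I_(m j)) x : V).
  by move=> x y /eqP; rewrite eq_Tagged /= => /eqP.
rewrite -[RHS]card_ord -(card_imset predT inj_j); apply: eq_card => v.
apply/idP/imsetP => [vj|[x _ ->]]; last exact: eqxx.
have /eqP : tag v == j := vj.
by case: v {vj} => i x /= ij; move: x; rewrite ij => x; exists x.
Qed.

Lemma card_multipartite_vertex : #|V| = n.
Proof.
rewrite card_tagged sumnE big_map big_enum /=.
by apply: eq_bigr => j _; rewrite card_ord.
Qed.

Local Notation L := (laplacian_mx R (@multipartite_adj k m)).

(** A vertex has degree [n] minus the size of its part, and the sum over its neighbours is the total
    sum minus the sum over its own part. *)
Lemma laplacian_mx_apply (a : 'I_#|V|) (f : V -> R[i]) :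
  \sum_c L a c * f (enum_val c) =
  (n%:R - (m (tag (enum_val a)))%:R) * f (enum_val a) - \sum_v f v
  + \sum_(v | tag v == tag (enum_val a)) f v.
Proof.
set u := enum_val a.
have deg_u : (#|[set v | multipartite_adj u v]%SET|)%:R =
    n%:R - (m (tag u))%:R :> R[i].
  have -> : n = (m (tag u) + #|[set v | multipartite_adj u v]%SET|)%N.
    rewrite -card_multipartite_vertex -(cardC [pred v : V | tag v == tag u]).
    congr addn; last by apply: eq_card => v; rewrite !inE /multipartite_adj eq_sym.
    apply/eqP; rewrite -(eqr_nat R); apply/eqP.
    by rewrite -[RHS]mulr1 -(sum_part_cst _ 1) sumr_const.
  by rewrite natrD; ring.
transitivity (\sum_c ((a == c)%:R * (n%:R - (m (tag u))%:R) * f (enum_val c)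
   - f (enum_val c) + (tag (enum_val c) == tag u)%:R * f (enum_val c))).
  apply: eq_bigr => c _; rewrite !mxE deg_u /multipartite_adj -/u.
  rewrite -[_ *+ (a == c)]mulr_natl [tag u == _]eq_sym.
  by move: (tag _ == _) => b; case: b => /=; ring.
rewrite !big_split /= sumrN; congr (_ - _ + _).
- rewrite (bigD1 a) //= eqxx mul1r big1 ?addr0 // => c /negPf ca.
  by rewrite eq_sym ca !mul0r.
- by rewrite [RHS](reindex _ (onW_bij _ (@enum_val_bij V))).
- rewrite [RHS]big_mkcond [RHS](reindex _ (onW_bij _ (@enum_val_bij V))) /=.
  by apply: eq_bigr => c _; case: eqP; rewrite ?mul1r ?mul0r.
Qed.

(** The index names an eigenspace: [None] the constants, [Some None] the functions constant on each
    part with total sum zero, [Some (Some j)] the functions supported on part [j] with sum zero.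
    Values may coincide and spaces may be zero, as for a part of size 1. *)
Definition laplacian_eigenvalue (s : option (option 'I_k)) : R :=
  match s with
  | None => 0
  | Some None => n%:R
  | Some (Some j) => n%:R - (m j)%:R
  end.

(** Entry [(v, u)] of the orthogonal projector onto the eigenspace: averaging over all vertices,
    averaging over parts minus averaging over all vertices, and the identity minus averaging on part
    [j]. *)
Definition laplacian_eigenfun (s : option (option 'I_k)) (v u : V) : R :=
  match s with
  | None => n%:R^-1
  | Some None => (tag v == tag u)%:R / (m (tag u))%:R - n%:R^-1
  | Some (Some j) =>
      (tag u == j)%:R * (tag v == j)%:R * ((v == u)%:R - (m j)%:R^-1)
  end.

Definition laplacian_projector s : 'M[R[i]]_#|V| :=
  \matrix_(a, b) real_complex R (laplacian_eigenfun s (enum_val a) (enum_val b)).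

Lemma sum_laplacian_projector : \sum_s laplacian_projector s = 1%:M.
Proof.
apply/matrixP => a b; rewrite summxE.
under eq_bigr do rewrite mxE.
rewrite -rmorph_sum !mxE -[RHS](rmorph_nat (real_complex R)); congr (real_complex R _).
rewrite big_option big_option /=.
have -> : (a == b) = (enum_val a == enum_val b :> V).
  by rewrite (inj_eq enum_val_inj).
set u := enum_val a; set v := enum_val b.
have [uv|uv] := eqVneq (tag u) (tag v); last first.
  rewrite big1 => [|j _]; last first.
    by case: eqP => [<-|_]; rewrite ?(negPf uv) ?mulr0 ?mul0r.
  have -> : (u == v) = false by apply: contraNF uv => /eqP ->.
  by rewrite /=; ring.
rewrite (bigD1 (tag v)) //= uv eqxx big1 => [|j]; last first.
  by rewrite eq_sym => /negPf ->; rewrite !mul0r.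
by rewrite /= mulr1n; ring.
Qed.

(** Every column is an eigenfunction: for [Some (Some j)] both sums in [laplacian_mx_apply] vanish,
    and for [Some None] the total sum vanishes while the sum over the own part cancels the term in
    [m]. *)
Lemma laplacian_mx_projector s :
  L *m laplacian_projector s =
  real_complex R (laplacian_eigenvalue s) *: laplacian_projector s.
Proof.
have m_neq0 j : (m j)%:R != 0 :> R by rewrite pnatr_eq0 -lt0n.
apply/matrixP => a b; rewrite !mxE.
under eq_bigr do rewrite [laplacian_projector _ _ _]mxE.
rewrite (laplacian_mx_apply a
  (fun v => real_complex R (laplacian_eigenfun s v (enum_val b)))).
set u := enum_val a; set v := enum_val b.
rewrite -!rmorph_sum -!(rmorph_nat (real_complex R)) -!(rmorphB, rmorphM, rmorphD).
congr (real_complex R _).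
have n_neq0 : n%:R != 0 :> R.
  rewrite pnatr_eq0 -card_multipartite_vertex -lt0n; apply/card_gt0P.
  by exists u.
have sumV c : \sum_(w : V) c = n%:R * c :> R.
  by rewrite sumr_const -card_multipartite_vertex mulr_natl.
have sumd : \sum_(w : V | tag w == tag v) ((w == v)%:R - (m (tag v))%:R^-1) = 0 :> R.
  rewrite sumrB sum_part_cst mulfV // (bigD1 v) //= eqxx big1 ?addr0 ?subrr //.
  by move=> w /andP[_ /negPf ->].
case: s => [[j|]|] /=.
- have [<-|vj] := eqVneq (tag v) j; last first.
    by rewrite !big1 => *; rewrite ?mul0r ?mulr0 ?mul0r; ring.
  have -> : \sum_w (true%:R * (tag w == tag v)%:R * ((w == v)%:R - (m (tag v))%:R^-1)) = 0 :> R.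
    rewrite -[RHS]sumd [RHS]big_mkcond; apply: eq_bigr => w _.
    by case: eqP => _; rewrite ?mulr0 ?mul0r ?mul1r.
  have -> : \sum_(w | tag w == tag u)
     (true%:R * (tag w == tag v)%:R * ((w == v)%:R - (m (tag v))%:R^-1)) = 0 :> R.
    have [uv|uv] := eqVneq (tag u) (tag v).
      rewrite -[RHS]sumd uv; apply: eq_bigr => w /eqP ->.
      by rewrite eqxx !mul1r.
    by rewrite big1 // => w /eqP ->; rewrite (negPf uv) mulr0 mul0r.
  have [uv|uv] := eqVneq (tag u) (tag v); last by rewrite mulr0 !mul0r; ring.
  by rewrite uv; ring.
- rewrite sumrB sumV mulfV //.
  have -> : \sum_(w : V) ((tag w == tag v)%:R / (m (tag v))%:R) = 1 :> R.
    rewrite -[RHS](mulfV (m_neq0 (tag v))) -[RHS]sum_part_cst [RHS]big_mkcond.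
    by apply: eq_bigr => w _; case: eqP => _ /=; rewrite ?mul1r ?mul0r.
  rewrite (eq_bigr (fun=> (tag u == tag v)%:R / (m (tag v))%:R - n%:R^-1)); last first.
    by move=> w /eqP ->.
  by rewrite sum_part_cst; ring.
- by rewrite sumV sum_part_cst; field.
Qed.

(** Between vertices of one part the projectors of the other parts have entry zero, which leaves
    three phases. Taking [v = u] gives the return amplitude, and [v != u] the transfer amplitude. *)
Lemma transition_modulusE (t : R) (u v : V) : tag v = tag u ->
  transition_modulus (@multipartite_adj k m) t u v =
  Num.sqrt (sqnorm3 n%:R^-1 ((u == v)%:R - (m (tag u))%:R^-1)
              ((m (tag u))%:R^-1 - n%:R^-1) (t * (n%:R - (m (tag u))%:R)) (t * n%:R)).
Proof.
move=> vu; rewrite /transition_modulus /transition_mx.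
rewrite (expmx_spectral _ sum_laplacian_projector laplacian_mx_projector).
rewrite summxE big_option big_option /= (bigD1 (tag u)) //= big1 => [|j]; last first.
  rewrite eq_sym => uj; rewrite !mxE !enum_rankK /= vu (negPf uj) !mul0r.
  by rewrite mulr0.
rewrite !mxE !enum_rankK /= vu eqxx mulr0 cos0 sin0.
by congr Num.sqrt; rewrite /sqnorm3 mulr1n; ring.
Qed.

End MultipartiteSpectrum.

(** * Trigonometric estimates *)

Section Trigonometry.
Variable R : realType.
Implicit Types (x y t : R) (p q : nat).

Lemma norm_sin_natmul q x : `|sin (q%:R * x)| <= q%:R * `|sin x|.
Proof.
elim: q => [|q IH]; first by rewrite !mul0r sin0 normr0.
rewrite -natr1 !mulrDl !mul1r sinD (le_trans (ler_normD _ _))// !normrM.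
apply: lerD.
  by apply: le_trans IH; rewrite ler_piMr ?normr_ge0 ?cos_max.
by rewrite ler_piMl ?normr_ge0 ?cos_max.
Qed.

Lemma cos_natmulN1 q x : cos x = -1 -> cos (q%:R * x) = (-1) ^+ q.
Proof.
move=> cx; have sx : sin x = 0 by apply: cos1sin0; rewrite cx normrN1.
elim: q => [|q IH]; first by rewrite mul0r cos0.
by rewrite -natr1 mulrDl mul1r cosD IH cx sx mulr0 subr0 exprSr.
Qed.

Lemma cos_natmul1 q x : cos x = 1 -> cos (q%:R * x) = 1.
Proof.
move=> cx; have sx : sin x = 0 by apply: cos1sin0; rewrite cx normr1.
elim: q => [|q IH]; first by rewrite mul0r cos0.
by rewrite -natr1 mulrDl mul1r cosD IH cx sx mulr0 subr0 mulr1.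
Qed.

Lemma cos_odd_pi (j : int) : odd `|j|%N -> cos (j%:~R * pi : R) = -1.
Proof.
move=> oj; rewrite -cos_norm normrM (ger0_norm (pi_ge0 R)) -intr_norm -abszE.
by rewrite -pmulrn cos_natmulN1 ?cospi // -signr_odd oj.
Qed.

Lemma cos_eq0_double t : cos t = 0 <-> cos (t * 2) = -1.
Proof.
rewrite mulr_natr cos_mulr2n; split => [->|h]; first by rewrite expr0n mul0rn sub0r.
by apply/eqP; rewrite -sqrf_eq0; apply/eqP; lra.
Qed.

Lemma cos_odd_pihalf (j : int) : odd `|j|%N -> cos (j%:~R * pi / 2 : R) = 0.
Proof. by move=> oj; apply/cos_eq0_double; rewrite divfK ?cos_odd_pi. Qed.

(** Since [q pi / 2] is an odd multiple of [pi / 2] for odd [q] and a multiple of [pi] for even [q],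
    [cos (q (pi/2 - t))] is, up to sign, the sine or the cosine of [q t]. *)
Lemma cos_natmul_complement q t :
  (if odd q then sin (q%:R * t) else cos (q%:R * t)) = 0 ->
  cos (q%:R * (pi / 2 - t)) = 0.
Proof.
rewrite mulrBr cosB.
have -> : q%:R * (pi / 2) = q%:Z%:~R * pi / 2 :> R by rewrite mulrA -pmulrn.
case: (boolP (odd q)) => oq ->; first by rewrite cos_odd_pihalf // mul0r mulr0 addr0.
have -> : q%:Z%:~R * pi / 2 = q./2%:R * pi :> R.
  by rewrite -pmulrn -{1}(even_halfK oq) -muln2 natrM; field.
rewrite cos1sin0 ?mulr0 ?mul0r ?addr0 //.
by rewrite cos_natmulN1 ?cospi // normrX normrN1 expr1n.
Qed.

Lemma natmul_sin_ge1 q y : cos (q%:R * y) = 0 -> 1 <= q%:R ^+ 2 * sin y ^+ 2.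
Proof.
move=> /eqP; rewrite -norm_sin_eq1 => /eqP s1.
rewrite -[sin y ^+ 2]real_normK ?num_real // -exprMn.
by rewrite expr_ge1 ?mulr_ge0 // -[leLHS]s1 norm_sin_natmul.
Qed.

(** Halve the angle, [y = 2 f]: then [sin (q f)^2 = 1/2], so it suffices that
    [|sin (q f)| <= q/2 |sin (2 f)|]. With [q = 2 r + 3], split [q f = r (2 f) + 3 f]; the remaining
    bound [|sin (3 f)| <= 3/2 |sin (2 f)|] holds once [cos f ^ 2 >= 1/2]. *)
Lemma natmul_sin_ge2 q y : odd q -> (3 <= q)%N -> cos (q%:R * y) = 0 ->
  2 <= q%:R ^+ 2 * sin y ^+ 2.
Proof.
move=> oq q3 cq.
suff main (f : R) : 1 / 2 <= cos f ^+ 2 -> cos (q%:R * (f *+ 2)) = 0 ->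
    2 <= q%:R ^+ 2 * sin (f *+ 2) ^+ 2.
  have y2 : y = (y / 2) *+ 2 by rewrite -mulr_natr; field.
  have [h|h] := leP (1 / 2) (cos (y / 2) ^+ 2); first by rewrite y2 main // -y2.
  (* Replacing [y] by [y + pi] turns [cos f ^ 2] into [sin f ^ 2], and changes [sin y] and
     [cos (q y)] at most in sign. *)
  have y2' : y + pi = (y / 2 + pi / 2) *+ 2 by rewrite -mulr_natr; field.
  have -> : sin y ^+ 2 = sin ((y / 2 + pi / 2) *+ 2) ^+ 2.
    by rewrite -y2' sinDpi sqrrN.
  apply: main; first by rewrite cosDpihalf sqrrN sin2cos2; lra.
  rewrite -y2' mulrDr mulr_natl [q%:R * pi]mulr_natl (alternatingn (@cosDpi R)).
  by rewrite -mulr_natl cq mulr0.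
move=> cf cqf.
have s2 : sin (q%:R * f) ^+ 2 = 1 / 2.
  by move: cqf; rewrite mulrnAr cos_mulr2n cos2sin2; lra.
have sf3 : `|sin (f *+ 2 + f)| <= 3 / 2 * `|sin (f *+ 2)|.
  have -> : sin (f *+ 2 + f) = sin f * (4 * cos f ^+ 2 - 1).
    rewrite sinD sin_mulr2n cos_mulr2n.
    by ring.
  have -> : sin (f *+ 2) = sin f * (2 * cos f) by rewrite sin_mulr2n; ring.
  rewrite !normrM [leRHS]mulrCA; apply: ler_wpM2l => //.
  rewrite ger0_norm; last by lra.
  have := cos_max f; move: cf; rewrite -[cos f ^+ 2]real_normK ?num_real //.
  rewrite normr_nat; set c := `|cos f| => c2 c1.
  have c0 : 0 <= c by exact: normr_ge0.
  (* The inequality [4 c^2 - 1 <= 3 c] is [(4 c + 1) (c - 1) <= 0]. *)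
  by nra.
have [r qr] : exists r, q = (r.*2 + 3)%N.
  exists (q - 3)./2; rewrite even_halfK ?subnK //.
  by rewrite oddB // oq.
have : `|sin (q%:R * f)| <= q%:R / 2 * `|sin (f *+ 2)|.
  have -> : q%:R * f = r%:R * (f *+ 2) + (f *+ 2 + f).
    by rewrite qr -muln2 natrD natrM -mulr_natr; ring.
  rewrite sinD (le_trans (ler_normD _ _)) // !normrM.
  have -> : q%:R / 2 * `|sin (f *+ 2)| =
    r%:R * `|sin (f *+ 2)| + 3 / 2 * `|sin (f *+ 2)|.
    by rewrite qr -muln2 natrD natrM; field.
  apply: lerD.
    by apply: le_trans (norm_sin_natmul _ _); rewrite ler_piMr ?cos_max.
  by apply: le_trans sf3; rewrite ler_piMl ?cos_max.
rewrite -(@ler_pXn2r _ 2) // ?nnegrE ?mulr_ge0 ?invr_ge0 //.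
rewrite exprMn !real_normK ?num_real // s2 expr_div_n; lra.
Qed.

End Trigonometry.

(** * Squared moduli of sums of three phases, and their minimisers *)

Section ReturnProbability.
Variable R : realType.
Implicit Types (a b c x y t : R) (n m : nat).

Lemma sqnorm3E a b c x y : sqnorm3 a b c x y =
  a ^+ 2 + b ^+ 2 + c ^+ 2 + 2 * a * b * cos x + 2 * a * c * cos y
  + 2 * b * c * cos (y - x).
Proof.
rewrite /sqnorm3 cosB; apply/eqP; rewrite -subr_eq0.
rewrite [X in X == 0](_ : _ = b ^+ 2 * (cos x ^+ 2 + sin x ^+ 2 - 1)
  + c ^+ 2 * (cos y ^+ 2 + sin y ^+ 2 - 1)); last by ring.
by rewrite !cos2Dsin2 subrr !mulr0 addr0.
Qed.

(* The same modulus after multiplication by [e^(-ix)]. *)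
Lemma sqnorm3_rotate a b c x y : sqnorm3 a b c x y =
  (b + a * cos x + c * cos (y - x)) ^+ 2 + (c * sin (y - x) - a * sin x) ^+ 2.
Proof.
rewrite sqnorm3E; have -> : cos y = cos (y - x + x) by rewrite subrK.
rewrite cosD; move: (y - x) => z; apply/eqP; rewrite eq_sym -subr_eq0.
rewrite [X in X == 0](_ : _ = a ^+ 2 * (cos x ^+ 2 + sin x ^+ 2 - 1)
  + c ^+ 2 * (cos z ^+ 2 + sin z ^+ 2 - 1)); last by ring.
by rewrite !cos2Dsin2 subrr !mulr0 addr0.
Qed.

(** Once the dominant term [b] is rotated to be real, the real part alone is at least
    [b - a - c >= 0]. *)
Lemma sqnorm3_ge a b c x y : 0 <= a -> 0 <= c -> a + c <= b ->
  (b - a - c) ^+ 2 <= sqnorm3 a b c x y.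
Proof.
move=> a0 c0 acb; rewrite sqnorm3_rotate.
apply: (@le_trans _ _ ((b + a * cos x + c * cos (y - x)) ^+ 2)); last first.
  by rewrite lerDl sqr_ge0.
have := ler_wpM2l a0 (cos_geN1 x); have := ler_wpM2l c0 (cos_geN1 (y - x)).
rewrite !mulrN1 => h1 h2.
by rewrite ler_pXn2r ?nnegrE //; lra.
Qed.

(** In the equality case the rotated real part is minimal, so each cosine with a positive
    coefficient is [-1]. *)
Lemma sqnorm3_min_phase a b c x y : 0 < a -> 0 <= c -> a + c < b ->
  sqnorm3 a b c x y = (b - a - c) ^+ 2 ->
  cos x = -1 /\ (0 < c -> cos (y - x) = -1).
Proof.
move=> a0 c0 acb; rewrite sqnorm3_rotate => sE.
have := ler_wpM2l (ltW a0) (cos_geN1 x).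
have := ler_wpM2l c0 (cos_geN1 (y - x)).
rewrite !mulrN1 => h1 h2.
have : (b + a * cos x + c * cos (y - x)) ^+ 2 <= (b - a - c) ^+ 2.
  by rewrite -sE lerDl sqr_ge0.
rewrite ler_pXn2r ?nnegrE //; [|lra..] => h3.
split=> [|cp].
  by apply: (mulfI (lt0r_neq0 a0)); lra.
by apply: (mulfI (lt0r_neq0 cp)); lra.
Qed.

Lemma periodic_continuous_min (f : R -> R) (T : R) : 0 < T -> continuous f ->
  periodic f T -> exists2 t0, 0 < t0 & forall t, f t0 <= f t.
Proof.
move=> T0 cf fT.
have TT : T <= T + T by rewrite lerDl ltW.
(* The period [[T, 2T]] is chosen to make the minimiser positive. *)
have [||t0 t0T fmin] := @EVT_min _ f T (T + T) => //.
  by apply: continuous_subspaceT.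
exists t0; first by move: t0T; rewrite in_itv /= => /andP[h _]; exact: lt_le_trans h.
move=> t; pose z := Num.floor (t / T).
have fz (j : int) s : f (s + T *~ j) = f s.
  case: j => j; first by rewrite -pmulrn (periodicn fT).
  by rewrite NegzE mulrNz -pmulrn -[in RHS](subrK (T *+ j.+1) s) [RHS](periodicn fT).
(* Subtracting [z] periods brings [t] into [[0, T)], and one more period brings it into
   [[T, 2T)]. *)
rewrite -(fz (1 - z) t); apply: fmin; rewrite in_itv /=.
have := floor_itv (t / T); rewrite -/z ler_pdivlMr // ltr_pdivrMr //.
move=> /andP[h1 h2]; rewrite mulrzBr mulr1z -mulrzl.
by rewrite -[(z + 1)%:~R]/_ intrD in h2; apply/andP; split; lra.
Qed.

Definition trig3 (A B C D x y z t : R) : R :=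
  A + B * cos (t * x) + C * cos (t * y) + D * cos (t * z).

Lemma is_derive_cosM x t : is_derive t 1 (fun s => cos (s * x)) (- x * sin (t * x)).
Proof.
have -> : (fun s => cos (s * x)) = cos \o ( *%R^~ x) by [].
apply: is_derive_eq.
by rewrite /GRing.scale /=; ring.
Qed.

Lemma is_derive_trig3 A B C D x y z t : is_derive t 1 (trig3 A B C D x y z)
  (- (B * x * sin (t * x) + C * y * sin (t * y) + D * z * sin (t * z))).
Proof.
have hx := is_derive_cosM x t; have hy := is_derive_cosM y t.
have hz := is_derive_cosM z t.
have h := is_deriveD (is_deriveD (is_deriveD (is_derive_cst A t 1)
  (is_deriveZ B hx)) (is_deriveZ C hy)) (is_deriveZ D hz).
have -> : - (B * x * sin (t * x) + C * y * sin (t * y) + D * z * sin (t * z)) =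
    0 + B * (- x * sin (t * x)) + C * (- y * sin (t * y)) + D * (- z * sin (t * z)).
  by move: (sin _) (sin _) (sin _) => sx sy sz; ring.
exact: h.
Qed.

Lemma continuous_trig3 A B C D x y z : continuous (trig3 A B C D x y z).
Proof.
move=> t; apply: differentiable_continuous; apply/derivable1_diffP.
by have [] := is_derive_trig3 A B C D x y z t.
Qed.

Lemma periodic_trig3 A B C D (p q r : nat) :
  periodic (trig3 A B C D p%:R q%:R r%:R) (pi *+ 2).
Proof.
have cosP (s : nat) t : cos ((t + pi *+ 2) * s%:R) = cos (t * s%:R) :> R.
  by rewrite mulrDl [pi *+ 2 * _]mulr_natr (periodicn (@cosD2pi R)).
by move=> t; rewrite /trig3 !cosP.
Qed.

(** Integer frequencies give the period [2 pi], hence a global minimiser at a positive time; the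
    equation is the vanishing of the derivative there. *)
Lemma trig3_min A B C D (p q r : nat) : exists2 t0, 0 < t0 &
  (forall t, trig3 A B C D p%:R q%:R r%:R t0 <= trig3 A B C D p%:R q%:R r%:R t) /\
  B * p%:R * sin (t0 * p%:R) + C * q%:R * sin (t0 * q%:R)
    + D * r%:R * sin (t0 * r%:R) = 0.
Proof.
have T0 : 0 < pi *+ 2 :> R by rewrite pmulrn_lgt0 ?pi_gt0.
have [t0 t00 tmin] := periodic_continuous_min T0
  (@continuous_trig3 A B C D p%:R q%:R r%:R) (@periodic_trig3 A B C D p q r).
exists t0 => //; split=> //.
have t0I : t0 \in `]t0 - 1, t0 + 1[%R by rewrite in_itv /=; apply/andP; split; lra.
have d0 : is_derive t0 1 (trig3 A B C D p%:R q%:R r%:R) 0.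
  by apply: derive1_at_min t0I _ => //; lra.
have [_ e1] := is_derive_trig3 A B C D p%:R q%:R r%:R t0.
have [_ e2] := d0.
by apply: oppr_inj; rewrite -e1 e2 oppr0.
Qed.

End ReturnProbability.

(** * Return and transfer probabilities *)

Section PartSizes.
Variable R : realType.
Implicit Types (t : R) (n m : nat).

(** The squared return modulus at a vertex in a part of size [m] of a graph on [n] vertices. *)
Definition return_prob n m t : R :=
  sqnorm3 n%:R^-1 (1 - m%:R^-1) (m%:R^-1 - n%:R^-1) (t * (n%:R - m%:R)) (t * n%:R).

Lemma return_probE n m t : (m <= n)%N -> return_prob n m t =
  trig3 (n%:R^-1 ^+ 2 + (1 - m%:R^-1) ^+ 2 + (m%:R^-1 - n%:R^-1) ^+ 2)
    (2 * n%:R^-1 * (1 - m%:R^-1)) (2 * n%:R^-1 * (m%:R^-1 - n%:R^-1))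
    (2 * (1 - m%:R^-1) * (m%:R^-1 - n%:R^-1)) (n - m)%:R n%:R m%:R t.
Proof.
move=> mn; rewrite /return_prob sqnorm3E /trig3 natrB //.
by have -> : t * n%:R - t * (n%:R - m%:R) = t * m%:R by ring.
Qed.

Lemma return_prob1_ge n t : (0 < n)%N -> (1 - 2 / n%:R) ^+ 2 <= return_prob n 1 t.
Proof.
move=> n0; rewrite return_probE // /trig3 invr1 subrr !(mulr0, mul0r, addr0).
have i0 : 0 < n%:R^-1 :> R by rewrite invr_gt0 ltr0n.
have i1 : n%:R^-1 <= 1 :> R by rewrite invf_le1 ?ltr0n // ler1n.
have c0 : 0 <= 2 * n%:R^-1 * (1 - n%:R^-1) :> R by rewrite !mulr_ge0 ?subr_ge0 // ltW.
have := ler_wpM2l c0 (cos_geN1 (t * n%:R)).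
rewrite mulrN1 !expr2; lra.
Qed.

Lemma return_prob1_min n t : cos (t * n%:R) = -1 ->
  return_prob n 1 t = (1 - 2 / n%:R) ^+ 2.
Proof.
by move=> c; rewrite /return_prob sqnorm3E c invr1 subrr !(mulr0, mul0r, addr0); ring.
Qed.

Lemma return_prob2E n t : (2 <= n)%N -> n%:R ^+ 2 * return_prob n 2 t =
  1 + n%:R ^+ 2 / 4 + (n%:R / 2 - 1) ^+ 2 + n%:R * cos (t * (n%:R - 2))
  + (n%:R - 2) * cos (t * n%:R) + n%:R * (n%:R / 2 - 1) * cos (t * 2).
Proof.
move=> n2; rewrite return_probE // /trig3 natrB //.
by field; rewrite pnatr_eq0; lia.
Qed.

(** There is one hypothesis for each factor of the derivative. Where [cos ((n-2)t/2)] or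
    [sin (nt/2)] vanishes, [n^2] times the probability is [(n-2)^2 cos^2 t] or [n^2 cos^2 t]
    respectively. *)
Lemma return_prob2_ge n (C : R) : (2 < n)%N ->
  (forall t, cos t = 0 -> C <= n%:R ^+ 2 * return_prob n 2 t) ->
  (forall t, cos (t * (n%:R - 2) / 2) = 0 -> C <= (n%:R - 2) ^+ 2 * cos t ^+ 2) ->
  (forall t, sin (t * n%:R / 2) = 0 -> C <= n%:R ^+ 2 * cos t ^+ 2) ->
  forall t, C <= n%:R ^+ 2 * return_prob n 2 t.
Proof.
move=> n2 HB HA HS t.
have n0 : n%:R != 0 :> R by rewrite pnatr_eq0; lia.
have nb : n%:R - 2 != 0 :> R by rewrite -natrB ?pnatr_eq0; lia.
set b : R := 1 - 2^-1; set c : R := 2^-1 - n%:R^-1.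
have [t0 _ [tmin crit]] := trig3_min (n%:R^-1 ^+ 2 + b ^+ 2 + c ^+ 2)
  (2 * n%:R^-1 * b) (2 * n%:R^-1 * c) (2 * b * c) (n - 2) n 2.
apply: (@le_trans _ _ (n%:R ^+ 2 * return_prob n 2 t0)); last first.
  rewrite ler_wpM2l ?sqr_ge0 // !return_probE //; lia.
set x := t0 * (n%:R - 2) / 2.
have e1 : t0 * (n%:R - 2) = x + x by rewrite /x; field.
have e2 : t0 * n%:R = (x + t0) + (x + t0) by rewrite /x; field.
have e3 : t0 * 2 = t0 + t0 by ring.
have e4 : t0 * n%:R / 2 = x + t0 by rewrite /x; field.
have ccx := cos2Dsin2 x; have cct := cos2Dsin2 t0.
have : sin (x + t0) * cos x * cos t0 = 0.
  (* All three coefficients in [crit] equal [(n - 2) / n]. *)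
  have : sin (t0 * (n%:R - 2)) + sin (t0 * n%:R) + sin (t0 * 2) = 0.
    apply: (mulfI (mulf_neq0 nb (invr_neq0 n0))); rewrite mulr0 -[RHS]crit.
    by rewrite natrB; [rewrite /b /c; field|lia].
  rewrite e1 e2 e3 [sin (x + t0 + _)]sinD !cosD !sinD.
  move: ccx cct; set cx := cos x; set sx := sin x; set ct := cos t0; set st := sin t0.
  move=> ccx cct h.
  apply: (mulfI (_ : 4 != 0 :> R)); first by rewrite pnatr_eq0.
  rewrite mulr0 -[RHS]h.
  apply/eqP; rewrite -subr_eq0.
  rewrite [X in X == 0](_ : _ = 2 * sx * cx * (ct ^+ 2 + st ^+ 2 - 1)
    + 2 * st * ct * (cx ^+ 2 + sx ^+ 2 - 1)); last by ring.
  by rewrite ccx cct subrr !mulr0 addr0.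
have ct2 : cos (t0 * 2) = 2 * cos t0 ^+ 2 - 1.
  by rewrite mulr_natr cos_mulr2n mulr_natl.
move=> /eqP; rewrite !mulf_eq0 => /orP[/orP[]|] /eqP h0.
- apply: le_trans (HS t0 _) _; rewrite ?e4 //.
  have ctn : cos (t0 * n%:R) = 1.
    by rewrite e2 cosD -!expr2 cos2sin2 h0 expr0n subr0 subr0.
  have stn : sin (t0 * n%:R) = 0 by rewrite e2 sinD h0 mul0r mulr0 addr0.
  have ctm : cos (t0 * (n%:R - 2)) = cos (t0 * 2).
    by rewrite mulrBr cosB ctn stn mul1r mul0r addr0.
  by rewrite (return_prob2E _ (ltnW n2)) ctn ctm ct2; lra.
- apply: le_trans (HA t0 _) _ => //.
  have ctm : cos (t0 * (n%:R - 2)) = -1.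
    by rewrite e1 cosD -!expr2 sin2cos2 h0 expr0n subr0 sub0r.
  have stm : sin (t0 * (n%:R - 2)) = 0 by rewrite e1 sinD h0 mul0r mulr0 addr0.
  have ctn : cos (t0 * n%:R) = - cos (t0 * 2).
    by rewrite -[n%:R](subrK 2) mulrDr cosD ctm stm mulN1r mul0r subr0.
  by rewrite (return_prob2E _ (ltnW n2)) ctn ctm ct2; lra.
- exact: HB.
Qed.

Lemma cos_complement t : cos t ^+ 2 = sin (pi / 2 - t) ^+ 2.
Proof. by rewrite sinB sin_pihalf cos_pihalf mul1r mul0r subr0. Qed.

Lemma return_prob2_mod4_min n t : n = 2 %[mod 4] -> cos t = 0 ->
  return_prob n 2 t = (2 / n%:R) ^+ 2.
Proof.
move=> n4 ct.
have n0 : n%:R != 0 :> R by rewrite pnatr_eq0; lia.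
have [q nq] : exists q, n = (4 * q + 2)%N by exists (n %/ 4)%N; lia.
apply: (mulfI (expf_neq0 2 n0)); rewrite return_prob2E; last by lia.
have c2 : cos (t * 2) = -1 by apply/cos_eq0_double.
have cm : cos (t * (n%:R - 2)) = 1.
  rewrite (_ : t * (n%:R - 2) = (2 * q)%:R * (t * 2)).
    by rewrite cos_natmulN1 // exprM -signr_odd /= expr0 expr1n.
  by rewrite nq natrD !natrM; ring.
have cn : cos (t * n%:R) = -1.
  rewrite (_ : t * n%:R = (2 * q).+1%:R * (t * 2)).
    by rewrite cos_natmulN1 // exprS exprM -signr_odd /= expr0 expr1n mulr1.
  by rewrite nq -natr1 natrD !natrM; ring.
by rewrite c2 cm cn; field.
Qed.

Lemma return_prob2_mod4_ge n t : n = 2 %[mod 4] -> (2 / n%:R) ^+ 2 <= return_prob n 2 t.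
Proof.
move=> n4.
(* For [n = 2] the part is the whole edgeless graph and the probability is constantly 1. *)
have [->|n2] := eqVneq n 2.
  rewrite return_probE // /trig3 subnn mulr0 cos0.
  by rewrite (_ : 2^-1 - 2^-1 = 0 :> R) ?subrr //; lra.
have {n2}n2 : (2 < n)%N by lia.
have n0 : n%:R != 0 :> R by rewrite pnatr_eq0; lia.
have n2p : 0 < n%:R ^+ 2 :> R by rewrite exprn_even_gt0.
rewrite -(ler_pM2l n2p) expr_div_n mulrC divfK ?expf_neq0 //.
have [q nq] : exists q, n = (4 * q + 2)%N by exists (n %/ 4)%N; lia.
move: t; apply: return_prob2_ge => // t ct.
- by rewrite return_prob2_mod4_min // expr_div_n mulrC divfK ?expf_neq0 //.
- have /natmul_sin_ge1 : cos ((2 * q)%:R * (pi / 2 - t)) = 0.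
    apply: cos_natmul_complement; rewrite oddM /= -[RHS]ct; congr cos.
    by rewrite nq natrD !natrM; field.
  rewrite -cos_complement (_ : n%:R - 2 = 2 * (2 * q)%:R).
    by rewrite exprMn; lra.
  by rewrite nq natrD !natrM; ring.
- have /natmul_sin_ge1 : cos ((2 * q).+1%:R * (pi / 2 - t)) = 0.
    apply: cos_natmul_complement; rewrite /= oddM /= -[RHS]ct; congr sin.
    by rewrite nq -natr1 natrD !natrM; field.
  rewrite -cos_complement (_ : n%:R = 2 * (2 * q).+1%:R).
    by rewrite exprMn; lra.
  by rewrite nq -natr1 natrD !natrM; ring.
Qed.

Lemma return_prob2_odd_half n t : odd n -> (2 <= n)%N -> cos t = 0 ->
  n%:R ^+ 2 * return_prob n 2 t = 2.
Proof.
move=> on n2 ct; rewrite return_prob2E //.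
have c2 : cos (t * 2) = -1 by apply/cos_eq0_double.
have codd q : odd q -> cos (t * q%:R) = 0.
  move=> oq; apply/cos_eq0_double.
  rewrite (_ : t * q%:R * 2 = q%:R * (t * 2)); last by ring.
  by rewrite cos_natmulN1 // -signr_odd oq expr1.
by rewrite -natrB // (codd n) // (codd (n - 2)%N) ?oddB ?on // c2; field.
Qed.

(** For odd [n] the first two factors lead to [cos (q y) = 0] with [q = n - 2] or [q = n]. The bound
    [C] stays free because [n = 3] allows [q = 1], while [n >= 5] forces [q >= 3]. *)
Lemma return_prob2_odd_ge n t (C : R) : odd n -> (2 < n)%N -> C <= 2 ->
  (forall q y, odd q -> (n - 2 <= q)%N -> cos (q%:R * y) = 0 ->
     C <= q%:R ^+ 2 * sin y ^+ 2) ->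
  C <= n%:R ^+ 2 * return_prob n 2 t.
Proof.
move=> on n2 C2 HC; move: t; apply: return_prob2_ge => // t ct.
- by rewrite return_prob2_odd_half // ltnW.
- rewrite cos_complement -natrB ?(ltnW n2) //; apply: HC => //.
    by rewrite oddB ?on // ltnW.
  have om : odd (n - 2) by rewrite oddB ?on // ltnW.
  apply: cos_natmul_complement; rewrite om natrB ?(ltnW n2) //.
  rewrite (_ : _ * t = (t * (n%:R - 2) / 2) *+ 2); last by rewrite -mulr_natr; field.
  by rewrite sin_mulr2n ct mul0r mul0rn.
- rewrite cos_complement; apply: HC => //; first exact: leq_subr.
  apply: cos_natmul_complement; rewrite on.
  rewrite (_ : _ * t = (t * n%:R / 2) *+ 2); last by rewrite -mulr_natr; field.
  by rewrite sin_mulr2n ct mulr0 mul0rn.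
Qed.

Lemma return_prob_part_ge n m t : (2 < m)%N -> (m <= n)%N ->
  (1 - 2 / m%:R) ^+ 2 <= return_prob n m t.
Proof.
move=> m2 mn; rewrite /return_prob.
have m0 : 0 < m%:R :> R by rewrite ltr0n; lia.
have n0 : 0 < n%:R :> R by rewrite ltr0n; lia.
have nm : n%:R^-1 <= m%:R^-1 :> R by rewrite lef_pV2 ?posrE // ler_nat.
have m3 : m%:R^-1 <= 1 / 3 :> R.
  by rewrite div1r lef_pV2 ?posrE // ler_nat.
have -> : 1 - 2 / m%:R = 1 - m%:R^-1 - n%:R^-1 - (m%:R^-1 - n%:R^-1) :> R by ring.
apply: sqnorm3_ge; first by rewrite invr_ge0 ltW.
  by rewrite subr_ge0.
by lra.
Qed.

Lemma return_prob_part_min n m t : (0 < m)%N -> (m <= n)%N ->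
  cos (t * m%:R) = -1 -> cos (t * n%:R) = 1 ->
  return_prob n m t = (1 - 2 / m%:R) ^+ 2.
Proof.
move=> m0 mn cm cn; rewrite return_probE // /trig3 natrB // [t * (_ - _)]mulrBr cosB cm cn.
have -> : sin (t * n%:R) = 0 by apply: cos1sin0; rewrite cn normr1.
ring.
Qed.

Lemma return_prob_part_lt n m t : (2 < m)%N -> (m <= n)%N ->
  (logn 2 n <= logn 2 m)%N -> (1 - 2 / m%:R) ^+ 2 != return_prob n m t.
Proof.
move=> m2 mn v2.
have m0 : 0 < m%:R :> R by rewrite ltr0n; lia.
have n0 : 0 < n%:R :> R by rewrite ltr0n; lia.
have nm : n%:R^-1 <= m%:R^-1 :> R by rewrite lef_pV2 ?posrE // ler_nat.
have m3 : m%:R^-1 <= 1 / 3 :> R.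
  by rewrite div1r lef_pV2 ?posrE // ler_nat.
apply/eqP; rewrite /return_prob => /esym.
have -> : 1 - 2 / m%:R = 1 - m%:R^-1 - n%:R^-1 - (m%:R^-1 - n%:R^-1) :> R by ring.
case/sqnorm3_min_phase; [by rewrite invr_gt0| by rewrite subr_ge0| by lra|].
move=> cx cy.
(* If [n = m] the third coefficient is zero and gives no phase, but the first phase is then
   constantly 1. *)
have [nEm|nm'] := eqVneq n m.
  by move: cx; rewrite nEm subrr mulr0 cos0; lra.
have {}cy : cos (t * m%:R) = -1.
  rewrite -[RHS]cy; first by congr cos; ring.
  by rewrite subr_gt0 ltf_pV2 ?posrE // ltr_nat ltn_neqAle eq_sym nm'.
have cn : cos (t * n%:R) = 1.
  rewrite -[n%:R](subrK m%:R) mulrDr cosD cx cy.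
  rewrite [sin (t * m%:R)]cos1sin0 ?cy ?normrN1 // mulr0 subr0; ring.
have [n' odd_n' nE] := pfactor_coprime (isT : prime 2)
  (ltn_trans (ltn0Sn 1) (leq_trans m2 mn)).
have [m' _ mE] := pfactor_coprime (isT : prime 2) (ltn_trans (ltn0Sn 1) m2).
rewrite coprime2n in odd_n'.
(* The phase of this common multiple of [t m] and [t n] would be both [-1] and [1]. *)
have nm2 : (n' * m = 2 ^ (logn 2 m - logn 2 n) * m' * n)%N.
  by rewrite {1}mE {2}nE -{1}(subnK v2) expnD; ring.
have : cos (n'%:R * (t * m%:R)) = -1.
  by rewrite cos_natmulN1 // -signr_odd odd_n' expr1.
rewrite mulrCA -natrM nm2 natrM mulrCA cos_natmul1 //; lra.
Qed.

End PartSizes.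

(** An odd [a / g] would leave the whole power of 2 of [a] in [g], hence in [b]; if both quotients
    were even, [2 g] would divide [g]. *)
Lemma parity_div_gcdn (a b : nat) : (0 < a)%N -> (0 < b)%N ->
  (logn 2 b < logn 2 a)%N -> ~~ odd (a %/ gcdn a b) /\ odd (b %/ gcdn a b).
Proof.
move=> a0 b0; set g := gcdn a b => v2.
have g0 : (0 < g)%N by rewrite gcdn_gt0 a0.
have aE : (a %/ g * g = a)%N by rewrite divnK ?dvdn_gcdl.
have bE : (b %/ g * g = b)%N by rewrite divnK ?dvdn_gcdr.
move: aE bE; set a' := (a %/ g)%N; set b' := (b %/ g)%N => aE bE.
have even_a : ~~ odd a'.
  apply/negP; rewrite -coprime2n => /logn_coprime a'0.
  have a'_gt0 : (0 < a')%N by move: a0; rewrite -aE muln_gt0 => /andP[].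
  have b'_gt0 : (0 < b')%N by move: b0; rewrite -bE muln_gt0 => /andP[].
  move: v2; rewrite -aE -bE !lognM //.
  by rewrite a'0 add0n ltnNge leq_addl.
split=> //; apply/negPn/negP => even_b.
have : (2 * g %| g)%N.
  by rewrite {2}/g dvdn_gcd -aE -bE !dvdn_pmul2r // !dvdn2 even_a even_b.
by move=> /(dvdn_leq g0); lia.
Qed.

Lemma inf_min (R : realType) (f : R -> R) (C t1 : R) :
  (forall t, C <= f t) -> 0 < t1 -> f t1 = C ->
  inf [set f t | t in [set t : R | 0 < t]]%classic = C.
Proof.
move=> fC t10 ft1; apply/eqP; rewrite eq_le; apply/andP; split.
  apply: ge_inf; last by exists t1.
  by exists C => _ [t _ <-].
by apply: lb_le_inf; [exists C; exists t1|move=> _ [t _ <-]].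
Qed.

(** * Perfect state transfer within a part of size 2 *)

Section PerfectStateTransfer.
Variable R : realType.
Variable n : nat.
Hypotheses (n_gt0 : (0 < n)%N) (n_mod4 : n = 0 %[mod 4]).
Implicit Types t : R.

(** The squared modulus of the entry between the two vertices of a part of size 2; off the diagonal
    the coefficient [1 - 1/2] becomes [- 1/2]. *)
Definition transfer_prob2 t : R :=
  sqnorm3 n%:R^-1 (- 2^-1) (2^-1 - n%:R^-1) (t * (n%:R - 2)) (t * n%:R).

Lemma transfer_prob2_pihalf : transfer_prob2 (pi / 2) = 1.
Proof.
have [q nq] : exists q, n = (4 * q)%N by exists (n %/ 4)%N; lia.
have n0 : n%:R != 0 :> R by rewrite pnatr_eq0; lia.
have cn : cos (pi / 2 * n%:R) = 1 :> R.
  rewrite (_ : pi / 2 * n%:R = (2 * q)%:R * pi); last by rewrite nq !natrM; field.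
  by rewrite cos_natmulN1 ?cospi // exprM -signr_odd /= expr0 expr1n.
have cm : cos (pi / 2 * (n%:R - 2)) = -1 :> R.
  rewrite mulrBr cosB cn divfK // cospi sinpi mulr0 addr0; ring.
rewrite /transfer_prob2 sqnorm3E cn cm.
rewrite (_ : pi / 2 * n%:R - pi / 2 * (n%:R - 2) = pi); last by field.
by rewrite cospi; field.
Qed.

(** The absolute values of the coefficients sum to 1, so modulus 1 is the equality case of the
    triangle inequality. As [n >= 4], the coefficient of [cos (2 t)] is strictly negative, which
    forces this cosine to [-1]. *)
Lemma transfer_prob2_eq1 t : transfer_prob2 t = 1 -> cos (t * 2) = -1.
Proof.
have n0 : 0 < n%:R :> R by rewrite ltr0n.
have n4 : n%:R^-1 <= 4^-1 :> R by rewrite lef_pV2 ?posrE // ler_nat; lia.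
have i0 : 0 < n%:R^-1 :> R by rewrite invr_gt0.
rewrite /transfer_prob2 sqnorm3E.
rewrite (_ : t * n%:R - t * (n%:R - 2) = t * 2); last by ring.
have h1 := ler_wpM2l (ltW i0) (cos_geN1 (t * (n%:R - 2))).
have cp : 0 < 2^-1 - n%:R^-1 :> R by lra.
have h2 := ler_wpM2l (ltW (mulr_gt0 i0 cp)) (cos_le1 (t * n%:R)).
have h3 := ler_wpM2l (ltW cp) (cos_geN1 (t * 2)).
rewrite mulrN1 in h1; rewrite mulr1 in h2; rewrite mulrN1 in h3.
move: h1 h2 h3; move: (cos _) (cos _) (cos _) => x y z h1 h2 h3 e.
apply: (mulfI (lt0r_neq0 cp)); rewrite mulrN1.
by move: cp h1 h2 h3 e; move: n%:R^-1 => i; rewrite ?expr2; lra.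
Qed.

Lemma transfer_prob2_time t : 0 < t -> transfer_prob2 t = 1 -> pi / 2 <= t.
Proof.
move=> t0 /transfer_prob2_eq1 c; rewrite leNgt; apply/negP => tpi.
have : cos pi < cos (t * 2).
  by rewrite ltr_cos ?in_itv /= ?pi_ge0 ?lexx //; [lra|apply/andP; split; lra].
by rewrite cospi c ltxx.
Qed.

End PerfectStateTransfer.

(** * From bounds on the return probability to attained infima *)

Section Sedentariness.
Variables (R : realType) (k : nat) (m : 'I_k -> nat).
Hypothesis m_gt0 : forall j : 'I_k, (0 < m j)%N.
Local Notation n := (\sum_(j < k) m j)%N.
Variable u : multipartite_vertex m.

Lemma transition_modulus_return (t : R) :
  transition_modulus (@multipartite_adj k m) t u u =
  Num.sqrt (return_prob n (m (tag u)) t).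
Proof. by rewrite transition_modulusE // eqxx. Qed.

Lemma part_le : (m (tag u) <= n)%N.
Proof. by rewrite (bigD1 (tag u)) //= leq_addr. Qed.

(** Two times occur because [t0] may be negative, [j] being any odd integer, whereas the infimum
    runs over positive times and needs the witness [t1]. *)
Lemma return_inf_attainedI (C t0 t1 : R) : 0 <= C -> 0 < t1 ->
  (forall t, C ^+ 2 <= return_prob n (m (tag u)) t) ->
  return_prob n (m (tag u)) t1 = C ^+ 2 ->
  return_prob n (m (tag u)) t0 = C ^+ 2 ->
  return_inf_attained_at (@multipartite_adj k m) u C t0.
Proof.
move=> C0 t10 geC e1 e0.
have C2 : C = Num.sqrt (C ^+ 2) by rewrite sqrtr_sqr ger0_norm.
split; last by rewrite transition_modulus_return e0 -C2.
apply: (inf_min (t1 := t1)) => // [t|].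
  by rewrite transition_modulus_return [leLHS]C2 ler_wsqrtr.
by rewrite transition_modulus_return e1 -C2.
Qed.

Lemma return_inf_attained_oddI (C d : R) : 0 <= C -> 0 < d ->
  (forall t, C ^+ 2 <= return_prob n (m (tag u)) t) ->
  (forall j : int, odd `|j|%N ->
     return_prob n (m (tag u)) (j%:~R * pi / d) = C ^+ 2) ->
  forall j : int, odd `|j|%N ->
    return_inf_attained_at (@multipartite_adj k m) u C (j%:~R * pi / d).
Proof.
move=> C0 d0 geC eC j oj.
apply: (return_inf_attainedI (t1 := 1%:~R * pi / d)) => //; last 2 first.
- exact: (eC 1).
- exact: eC.
by rewrite mul1r divr_gt0 ?pi_gt0.
Qed.

End Sedentariness.

(** * The five cases according to the size of the part *)

Theorem theorem19 (R : realType) (k : nat) (m : 'I_k -> nat)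
    (m_gt0 : forall j : 'I_k, (0 < m j)%N) (n : nat)
    (n_def : n = (\sum_(j < k) m j)%N) (l : 'I_k)
    (u : multipartite_vertex m) (u_l : tag u = l) :
  [/\ (* (1) *)
      m l = 1%N ->
      forall j : int, odd `|j|%N ->
        ((3 <= n)%N ->
           tightly_sedentary_at (@multipartite_adj k m) u
             (1 - 2 / n%:R : R) (j%:~R * pi / n%:R)) /\
        (n = 2%N ->
           return_inf_attained_at (@multipartite_adj k m) u
             (1 - 2 / n%:R : R) (j%:~R * pi / n%:R)),
      (* (2) *)
      m l = 2%N -> n = 0 %[mod 4] ->
      forall v : multipartite_vertex m, tag v = l -> v != u ->
        minimum_PST_time (@multipartite_adj k m) u v (pi / 2 : R),
      (* (3) *)
      m l = 2%N -> n = 2 %[mod 4] ->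
      forall j : int, odd `|j|%N ->
        tightly_sedentary_at (@multipartite_adj k m) u
          (2 / n%:R : R) (j%:~R * pi / 2),
      (* (4) *)
      m l = 2%N -> odd n ->
      (n = 3%N -> forall j : int, odd `|j|%N ->
         tightly_sedentary_at (@multipartite_adj k m) u
           (1 / 3 : R) (j%:~R * pi)) /\
      ((5 <= n)%N -> forall j : int, odd `|j|%N ->
         tightly_sedentary_at (@multipartite_adj k m) u
           (Num.sqrt 2 / n%:R : R) (j%:~R * pi / 2))
    & (* (5) *)
      (3 <= m l)%N ->
      exists C : R,
        [/\ exists2 t0 : R, 0 < t0 &
              tightly_sedentary_at (@multipartite_adj k m) u C t0,
            (logn 2 (m l) < logn 2 n)%N ->
              C = 1 - 2 / (m l)%:R /\
              forall j : int, odd `|j|%N ->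
                tightly_sedentary_at (@multipartite_adj k m) u C
                  (j%:~R * pi / (gcdn n (m l))%:R)
          & ~~ (logn 2 (m l) < logn 2 n)%N -> 1 - 2 / (m l)%:R < C]].
Proof.
subst n l; set n := (\sum_(j < k) m j)%N.
have n_gt0 : (0 < n)%N := leq_trans (m_gt0 _) (part_le u).
have nR0 : 0 < n%:R :> R by rewrite ltr0n.
split.
- move=> m1 j oj.
  (* For [n = 2] the infimum is still attained, but its value is 0. *)
  have att : (2 <= n)%N -> return_inf_attained_at (@multipartite_adj k m) u
      (1 - 2 / n%:R : R) (j%:~R * pi / n%:R).
    move=> n2; apply: return_inf_attained_oddI => //; rewrite ?m1.
    + by rewrite subr_ge0 ler_pdivrMr // mul1r ler_nat.
    + by move=> t; apply: return_prob1_ge.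
    by move=> i oi; rewrite return_prob1_min // divfK ?gt_eqF // cos_odd_pi.
  split=> [n3|n2]; last by apply: att; rewrite n2.
  split; last by apply: att; lia.
  by rewrite subr_gt0 ltr_pdivrMr // mul1r ltr_nat.
- move=> m2 n4 v vl vu.
  have modE t : transition_modulus (@multipartite_adj k m) t u v =
      Num.sqrt (transfer_prob2 n t) :> R.
    rewrite transition_modulusE // eq_sym (negPf vu) m2 /transfer_prob2.
    by rewrite mulr0n sub0r.
  split; first by rewrite divr_gt0 ?pi_gt0.
    by rewrite /perfect_state_transfer_at modE transfer_prob2_pihalf // sqrtr1.
  move=> s s0; rewrite /perfect_state_transfer_at modE => s1.
  apply: (@transfer_prob2_time R n) => //.
  by rewrite -[LHS]sqr_sqrtr ?s1 ?expr1n // addr_ge0 ?sqr_ge0.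
- move=> m2 n4 j oj; split; first by rewrite divr_gt0.
  apply: return_inf_attained_oddI => //; rewrite ?m2.
    by move=> t; apply: return_prob2_mod4_ge.
  by move=> i oi; rewrite return_prob2_mod4_min // cos_odd_pihalf.
- move=> m2 on; split=> [n3 j oj|n5 j oj].
    (* At odd multiples of [pi] the amplitude is [1/3 - 1/2 - 1/6 = - 1/3]. *)
    have rpi (i : int) : odd `|i|%N -> return_prob n 2 (i%:~R * pi) = (1 / 3) ^+ 2 :> R.
      move=> /(@cos_odd_pi R); rewrite n3; set t := _ * pi => ct.
      have c3 : cos (t * 3) = -1.
        by rewrite mulrC cos_natmulN1 // !exprS expr0; ring.
      have c2 : cos (t * 2) = 1 by rewrite mulrC cos_natmulN1 // expr2; ring.
      rewrite /return_prob sqnorm3E (_ : t * (3 - 2) = t); last by ring.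
      rewrite (_ : t * 3 - t = t * 2); last by ring.
      by rewrite ct c2 c3; field.
    split; first by [].
    apply: (return_inf_attainedI m_gt0 (t1 := 1%:~R * pi)) => //; rewrite ?m2 ?rpi //.
      by rewrite mul1r pi_gt0.
    (* Here [q = 1] can occur, so the bound is 1, below the value 2 taken where [cos t = 0]. *)
    move=> t; rewrite -/n; have : 1 <= n%:R ^+ 2 * return_prob n 2 t.
      apply: return_prob2_odd_ge; rewrite ?n3 //; first by lra.
      by move=> q y _ _; exact: natmul_sin_ge1.
    by rewrite n3 expr_div_n expr1n; lra.
  split; first by rewrite divr_gt0 // sqrtr_gt0.
  have C2 : (Num.sqrt 2 / n%:R) ^+ 2 = 2 / n%:R ^+ 2 :> R.
    by rewrite expr_div_n sqr_sqrtr.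
  apply: return_inf_attained_oddI => //; rewrite ?C2 ?m2.
    move=> t; rewrite ler_pdivrMr ?exprn_gt0 // mulrC.
    apply: return_prob2_odd_ge => //; first by lia.
    by move=> q y oq qn; apply: natmul_sin_ge2 => //; lia.
  move=> i oi; apply: (mulfI (expf_neq0 2 (lt0r_neq0 nR0))).
  rewrite return_prob2_odd_half ?cos_odd_pihalf //; last by lia.
  by rewrite mulrC divfK // expf_neq0 // lt0r_neq0.
- set ml := m (tag u) => m3.
  have mR0 : 0 < ml%:R :> R by rewrite ltr0n; lia.
  have mn : (ml <= n)%N := part_le u.
  have c0 : 0 < 1 - 2 / ml%:R :> R.
    by rewrite subr_gt0 ltr_pdivrMr // mul1r ltr_nat.
  have [v2|v2] := boolP (logn 2 ml < logn 2 n)%N.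
    set g := gcdn n ml.
    have g0 : (0 < g)%N by rewrite gcdn_gt0 n_gt0.
    have gR0 : 0 < g%:R :> R by rewrite ltr0n.
    have att (j : int) : odd `|j|%N ->
        tightly_sedentary_at (@multipartite_adj k m) u (1 - 2 / ml%:R)
          (j%:~R * pi / g%:R : R).
      move=> oj; split=> //.
      apply: return_inf_attained_oddI => //; rewrite -/ml ?ltW //.
        by move=> t; apply: return_prob_part_ge.
      move=> i oi.
      have [even_n odd_m] := parity_div_gcdn n_gt0 (leq_trans (isT : 0 < 3)%N m3) v2.
      (* At this time the phase of frequency [p] is [p / g] times an odd multiple of [pi], so the
         parity of [p / g] decides its sign. *)
      have cdiv p : (g %| p)%N -> cos (i%:~R * pi / g%:R * p%:R) = (-1) ^+ (p %/ g) :> R.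
        move=> gp; rewrite -{1}(divnK gp) natrM mulrCA divfK ?gt_eqF //.
        by rewrite cos_natmulN1 // cos_odd_pi.
      apply: return_prob_part_min => //; first by lia.
        by rewrite cdiv ?dvdn_gcdr // -signr_odd odd_m.
      by rewrite cdiv ?dvdn_gcdl // -signr_odd (negPf even_n).
    exists (1 - 2 / ml%:R); split=> [|//|//].
    exists (1%:~R * pi / g%:R); last exact: att.
    by rewrite mul1r divr_gt0 ?pi_gt0.
  (* Here [C] is not explicit: it is the square root of the global minimum, and the equality case
     excludes the value [1 - 2 / ml]. *)
  have [t0 t00 [tmin _]] := trig3_min
    (n%:R^-1 ^+ 2 + (1 - ml%:R^-1) ^+ 2 + (ml%:R^-1 - n%:R^-1) ^+ 2 : R)
    (2 * n%:R^-1 * (1 - ml%:R^-1)) (2 * n%:R^-1 * (ml%:R^-1 - n%:R^-1))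
    (2 * (1 - ml%:R^-1) * (ml%:R^-1 - n%:R^-1)) (n - ml) n ml.
  set C := Num.sqrt (return_prob n ml t0).
  have C2 : C ^+ 2 = return_prob n ml t0.
    by rewrite sqr_sqrtr // addr_ge0 ?sqr_ge0.
  have cC : 1 - 2 / ml%:R < C.
    rewrite -(@ltr_pXn2r _ 2) ?nnegrE ?sqrtr_ge0 ?(ltW c0) // C2 lt_neqAle.
    by rewrite return_prob_part_lt ?return_prob_part_ge // leqNgt.
  exists C; split=> [|//|//].
  exists t0 => //; split; first exact: lt_trans cC.
  apply: (return_inf_attainedI m_gt0 (t1 := t0)) => //; rewrite ?sqrtr_ge0 //.
  by move=> t; rewrite C2 -/ml !return_probE.
Qed.
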